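(* Let $\Lambda$ be a row-finite $k$-graph without sources. Let $\mathcal{H}(\Lambda)$ be the lattice of hereditary saturated subsets of $\Lambda^0$ and $\mathcal{L}(T_\Lambda)$ the lattice of $\mathbb{Z}^k$-order ideals of $T_\Lambda$, both ordered by inclusion. Define $\rho:\mathcal{H}(\Lambda)\to\mathcal{L}(T_\Lambda)$ by $\rho(H)=\langle H\rangle$, and $\eta:\mathcal{L}(T_\Lambda)\to\mathcal{H}(\Lambda)$ by $\eta(J)=H_J=\{v\in\Lambda^0: v(0)\in J\}$. Then $\rho$ and $\eta$ are order preserving mutually inverse maps, and hence $\mathcal{H}(\Lambda)$ is lattice isomorphic with $\mathcal{L}(T_\Lambda)$.
   Context: **$k$-graphs.** $\mathbb{N}=\{0,1,2,\dots\}$, $k\ge 1$, $e_i$ is the $i$-th standard generator of $\mathbb{N}^k$. A $k$-graph is a countable small category $\Lambda$ with object set $\Lambda^0$ (identified with the identity morphisms), range and source maps $r,s:\Lambda\to\Lambda^0$, and a functor $d:\Lambda\to\mathbb{N}^k$ with the unique factorization property: if $d(\lambda)=m+n$ there are unique $\mu_1,\mu_2\in\Lambda$ with $\lambda=\mu_1\mu_2$, $d(\mu_1)=m$, $d(\mu_2)=n$ (the product $\mu_1\mu_2$ is defined iff $s(\mu_1)=r(\mu_2)$). $v\Lambda^n=\{\lambda: r(\lambda)=v, d(\lambda)=n\}$. $\Lambda$ is row-finite if every $v\Lambda^n$ is finite, and has no sources if every $v\Lambda^n$ is nonempty. $H\subseteq\Lambda^0$ is hereditary if $r(\lambda)\in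 H$ implies $s(\lambda)\in H$ for $\lambda\in\Lambda$; saturated if for $v\in\Lambda^0$, $n\in\mathbb{N}^k$, $s(v\Lambda^n)\subseteq H$ implies $v\in H$. **Talented monoid.** $T_\Lambda$ is the commutative monoid generated by symbols $v(n)$ ($v\in\Lambda^0$, $n\in\mathbb{Z}^k$) subject to $v(n)=\sum_{\alpha\in v\Lambda^{e_i}}s(\alpha)(n+e_i)$ for all $v$, $n$ and $i\in\{1,\dots,k\}$ with $v\Lambda^{e_i}\neq\emptyset$. $\mathbb{Z}^k$ acts on it by monoid automorphisms determined by ${}^{n}v(m)=v(m+n)$. With $x\le y$ iff $y=x+z$ for some $z$, a $\mathbb{Z}^k$-order ideal is a submonoid $J$ closed under the action such that $x\le y\in J$ implies $x\in J$. For $X\subseteq\Lambda^0$, $\langle X\rangle$ is the $\mathbb{Z}^k$-order ideal generated by $\{v(0): v\in X\}$ (and $\langle\emptyset\rangle=\{0\}$). *)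

(* Defs.v *)
From HB Require Import structures.
From mathcomp Require Import all_boot all_order all_algebra.
From mathcomp Require Import finmap multiset generic_quotient.
From mathcomp Require Import boolp classical_sets cardinality.

Set Implicit Arguments.
Unset Strict Implicit.
Unset Printing Implicit Defensive.

Import Order.TTheory GRing.Theory.

Local Open Scope mset_scope.
Local Open Scope classical_set_scope.
Local Open Scope ring_scope.
Local Open Scope quotient_scope.

(* A small category with countably many morphisms and a degree functor to N^k,
   the latter represented as row vectors. [mcomp a b] is the product ab, with
   range [rng a] and source [src b]; it is a total function whose value is
   unconstrained, and never used, unless [src a = rng b]. The objects form a
   separate type, embedded in the morphisms by [idm]. *)
Record kgraph (k : nat) := KGraph {
  obj : countType;
  mor : countType;
  rng : mor -> obj;
  src : mor -> obj;
  idm : obj -> mor;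
  mcomp : mor -> mor -> mor;
  deg : mor -> 'rV[nat]_k;
  rng_idm : forall v, rng (idm v) = v;
  src_idm : forall v, src (idm v) = v;
  rng_mcomp : forall a b, src a = rng b -> rng (mcomp a b) = rng a;
  src_mcomp : forall a b, src a = rng b -> src (mcomp a b) = src b;
  mcomp_idl : forall a, mcomp (idm (rng a)) a = a;
  mcomp_idr : forall a, mcomp a (idm (src a)) = a;
  mcomp_assoc : forall a b c, src a = rng b -> src b = rng c ->
    mcomp a (mcomp b c) = mcomp (mcomp a b) c;
  deg_idm : forall v, deg (idm v) = 0;
  deg_mcomp : forall a b, src a = rng b -> deg (mcomp a b) = deg a + deg b;
  unique_factorization : forall a m n, deg a = m + n ->
    exists! p : mor * mor,
      [/\ src p.1 = rng p.2, a = mcomp p.1 p.2, deg p.1 = m & deg p.2 = n]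
}.

Section KGraphTheory.
Variables (k : nat) (L : kgraph k).

Definition paths (v : obj L) (n : 'rV[nat]_k) : set (mor L) :=
  [set a | rng a = v /\ deg a = n].

Definition row_finite : Prop := forall v n, finite_set (paths v n).

Definition no_sources : Prop := forall v n, paths v n !=set0.

Definition hereditary (H : set (obj L)) : Prop :=
  forall a : mor L, H (rng a) -> H (src a).

Definition saturated (H : set (obj L)) : Prop :=
  forall v n, (@src k L) @` paths v n `<=` H -> H v.

End KGraphTheory.

Section TalentedMonoid.
Variables (k : nat) (L : kgraph k).

(* The free commutative monoid on the symbols v(n) is the type of finite
   multisets of pairs (v, n). *)
Definition symbol : choiceType := (obj L * 'rV[int]_k)%type.

(* The smallest monoid congruence on it containing the defining relations.
   [delta_mx 0 i] is the generator e_i; [fset_set] enumerates a finite set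
   (so the relation is meaningful when v Lambda^{e_i} is finite). *)
Inductive talented_congr : {mset symbol} -> {mset symbol} -> Prop :=
| TalentedRel (v : obj L) (n : 'rV[int]_k) (i : 'I_k) :
    paths v (delta_mx 0 i) !=set0 ->
    talented_congr [mset ((v, n) : symbol)]
      (seq_mset [seq ((src a, n + delta_mx 0 i) : symbol)
                | a <- fset_set (paths v (delta_mx 0 i))])
| TalentedRefl x : talented_congr x x
| TalentedSym x y : talented_congr x y -> talented_congr y x
| TalentedTrans x y z :
    talented_congr x y -> talented_congr y z -> talented_congr x z
| TalentedAdd z x y :
    talented_congr x y -> talented_congr (z `+` x)%mset (z `+` y)%mset.

Definition talented_eq (x y : {mset symbol}) : bool := `[< talented_congr x y >].

Lemma talented_eq_refl : reflexive talented_eq.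
Proof. by move=> x; apply/asboolP; apply: TalentedRefl. Qed.

Lemma talented_eq_sym : symmetric talented_eq.
Proof.
by move=> x y; apply/asboolP/asboolP; apply: TalentedSym.
Qed.

Lemma talented_eq_trans : transitive talented_eq.
Proof.
by move=> y x z /asboolP xy /asboolP yz; apply/asboolP/(TalentedTrans xy yz).
Qed.

Canonical talented_equiv :=
  EquivRel talented_eq talented_eq_refl talented_eq_sym talented_eq_trans.

Definition talented := {eq_quot talented_equiv}.

HB.instance Definition _ := Choice.on talented.
HB.instance Definition _ := EqQuotient.on talented.

Lemma talentedP (x y : {mset symbol}) :
  \pi_talented x = \pi_talented y <-> talented_congr x y.
Proof.
split=> [/eqP|xy]; first by rewrite eqmodE => /asboolP.
by apply/eqP; rewrite eqmodE; apply/asboolP.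
Qed.

Definition talented_zero : talented := \pi_talented (mset0 : {mset symbol}).

Definition talented_add (x y : talented) : talented :=
  \pi_talented (repr x `+` repr y)%mset.

Lemma pi_addE (x y : {mset symbol}) :
  talented_add (\pi_talented x) (\pi_talented y) = \pi_talented (x `+` y)%mset.
Proof.
apply/talentedP.
have hx : talented_congr (repr (\pi_talented x)) x.
  by apply/talentedP; rewrite reprK.
have hy : talented_congr (repr (\pi_talented y)) y.
  by apply/talentedP; rewrite reprK.
apply: (TalentedTrans (TalentedAdd _ hy)).
rewrite msetDC [X in talented_congr _ X]msetDC.
exact: TalentedAdd.
Qed.

Lemma talented_addA : associative talented_add.
Proof.
move=> x y z; rewrite -[x]reprK -[y]reprK -[z]reprK.
by rewrite !pi_addE !reprK msetDA.
Qed.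

Lemma talented_addC : commutative talented_add.
Proof. by move=> x y; rewrite /talented_add msetDC. Qed.

Lemma talented_add0 : left_id talented_zero talented_add.
Proof. by move=> x; rewrite -[x]reprK pi_addE mset0D. Qed.

HB.instance Definition _ := GRing.isNmodule.Build talented
  talented_addA talented_addC talented_add0.

Definition gen (v : obj L) (n : 'rV[int]_k) : talented :=
  \pi_talented [mset ((v, n) : symbol)].

Lemma pi_seq_mset (s : seq symbol) :
  \pi_talented (seq_mset s) = \sum_(x <- s) gen x.1 x.2.
Proof.
elim: s => [|[v n] s IHs].
  rewrite big_nil; congr (\pi_talented _).
  by apply/msetP => a; rewrite mset_seqE mset0E.
by rewrite big_cons mset_cons -IHs -pi_addE.
Qed.

Lemma gen_rel (v : obj L) (n : 'rV[int]_k) (i : 'I_k) :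
  paths v (delta_mx 0 i) !=set0 ->
  gen v n = \sum_(a <- fset_set (paths v (delta_mx 0 i)))
              gen (src a) (n + delta_mx 0 i).
Proof.
move=> /(TalentedRel n) /talentedP; rewrite /gen => ->.
by rewrite pi_seq_mset big_map.
Qed.

Definition shift (n : 'rV[int]_k) (x : {mset symbol}) : {mset symbol} :=
  seq_mset [seq ((y.1, y.2 + n) : symbol) | y <- x].

Definition act (n : 'rV[int]_k) (x : talented) : talented :=
  \pi_talented (shift n (repr x)).

Lemma shift_seq n (s : seq symbol) :
  shift n (seq_mset s) = seq_mset [seq ((y.1, y.2 + n) : symbol) | y <- s].
Proof. by apply/eq_seq_msetP/perm_map/perm_eq_seq_mset. Qed.

Lemma mset_seqD (s t : seq symbol) :
  seq_mset (s ++ t) = (seq_mset s `+` seq_mset t)%mset.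
Proof. by apply/msetP => a; rewrite msetE2 !mset_seqE count_cat. Qed.

Lemma shiftD n x y : shift n (x `+` y)%mset = (shift n x `+` shift n y)%mset.
Proof.
by rewrite -[x]seq_mset_id -[y]seq_mset_id -mset_seqD !shift_seq map_cat mset_seqD.
Qed.

Lemma mset1_seq (y : symbol) : [mset y] = seq_mset [:: y].
Proof. by apply/msetP => a; rewrite mset_seqE msetnE /= addn0 eq_sym; case: eqP. Qed.

Lemma shift1 n v m : shift n [mset ((v, m) : symbol)] = [mset ((v, m + n) : symbol)].
Proof. by rewrite !mset1_seq shift_seq. Qed.

Lemma shift_congr n x y :
  talented_congr x y -> talented_congr (shift n x) (shift n y).
Proof.
elim=> [v m i ne||||z {}x {}y _ IH].
- rewrite shift1 shift_seq -map_comp.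
  rewrite (eq_map (g := fun a => (src a, (m + n) + delta_mx 0 i))); last first.
    by move=> a /=; rewrite addrAC.
  exact: TalentedRel.
- by move=> z; apply: TalentedRefl.
- by move=> z t _; apply: TalentedSym.
- by move=> z t u _ zt _; apply: TalentedTrans.
- by rewrite !shiftD; apply: TalentedAdd.
Qed.

Lemma pi_actE n (x : {mset symbol}) :
  act n (\pi_talented x) = \pi_talented (shift n x).
Proof. by apply/talentedP/shift_congr/talentedP; rewrite reprK. Qed.

Lemma act_gen n v m : act n (gen v m) = gen v (m + n).
Proof. by rewrite /gen pi_actE shift1. Qed.

Lemma actD n x y : act n (x + y) = act n x + act n y.
Proof.
rewrite -[x]reprK -[y]reprK.
by rewrite [LHS](congr1 (act n) (pi_addE (repr x) (repr y))) !pi_actE shiftD -pi_addE.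
Qed.

Definition tle (x y : talented) : Prop := exists z, y = x + z.

Record order_ideal (J : set talented) : Prop := OrderIdeal {
  ideal0 : J 0;
  idealD : forall x y, J x -> J y -> J (x + y);
  ideal_act : forall n x, J x -> J (act n x);
  ideal_le : forall x y, tle x y -> J y -> J x
}.

End TalentedMonoid.

(* A family of subsets stable under arbitrary intersections (the empty
   intersection being the whole type) is a lattice for inclusion: meets are
   intersections, and the join of A and B is the smallest closed set
   containing both. *)
Record closure_system (T : Type) := ClosureSystem {
  closed_in : set (set T);
  closed_bigcap : forall F : set (set T),
    F `<=` closed_in -> closed_in (\bigcap_(A in F) A)
}.

Section ClosedSets.
Variables (T : Type) (C : closure_system T).

Record closed_set := ClosedSet {
  closed_set_val :> set T;
  closed_set_valP : `[< closed_in C closed_set_val >]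
}.

HB.instance Definition _ := [isSub for closed_set_val].
HB.instance Definition _ := [Choice of closed_set by <:].
HB.instance Definition _ := [SubChoice_isSubPOrder of closed_set by <: with set_display].

Lemma closed_setP (A : closed_set) : closed_in C A.
Proof. exact/asboolP/closed_set_valP. Qed.

Lemma closed_set_leP (A B : closed_set) : reflect (A `<=` B) (A <= B)%O.
Proof. by rewrite leEsub; apply: (iffP idP); rewrite subsetEset. Qed.

Lemma hull_subproof (X : set T) :
  `[< closed_in C (\bigcap_(A in [set A | closed_in C A /\ X `<=` A]) A) >].
Proof. by apply/asboolP/closed_bigcap => A []. Qed.

Definition hull (X : set T) : closed_set := ClosedSet (hull_subproof X).

Lemma hull_min (X : set T) (A : closed_set) : X `<=` A -> hull X `<=` A.
Proof. by move=> XA x; apply; split=> //; exact: closed_setP. Qed.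

Lemma sub_hull (X : set T) : X `<=` hull X.
Proof. by move=> x Xx A [_]; apply. Qed.

Lemma meet_subproof (A B : closed_set) : `[< closed_in C (A `&` B) >].
Proof.
rewrite (_ : A `&` B = \bigcap_(X in [set (A : set T); (B : set T)]) X).
  by apply/asboolP/closed_bigcap => X [] ->; exact: closed_setP.
apply/seteqP; split=> [x [Ax Bx] X [] -> //|x AB].
by split; apply: AB; [left|right].
Qed.

Definition closed_meet (A B : closed_set) : closed_set :=
  ClosedSet (meet_subproof A B).

Definition closed_join (A B : closed_set) : closed_set := hull (A `|` B).

Lemma closed_meetP (X A B : closed_set) :
  (X <= closed_meet A B)%O = (X <= A)%O && (X <= B)%O.
Proof.
apply/closed_set_leP/andP => /= [XAB|[/closed_set_leP XA /closed_set_leP XB]].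
  by split; apply/closed_set_leP => x /XAB [].
by move=> x Xx; split; [exact: XA|exact: XB].
Qed.

Lemma closed_joinP (A B X : closed_set) :
  (closed_join A B <= X)%O = (A <= X)%O && (B <= X)%O.
Proof.
apply/closed_set_leP/andP => [ABX|[/closed_set_leP AX /closed_set_leP BX]].
  by split; apply/closed_set_leP => x Ax; apply: ABX; apply: sub_hull; [left|right].
by apply: hull_min => x [/AX|/BX].
Qed.

HB.instance Definition _ := Order.POrder_MeetJoin_isLattice.Build
  set_display closed_set closed_meetP closed_joinP.

End ClosedSets.

Section Lattices.
Variables (k : nat) (L : kgraph k).

Lemma hersat_bigcap (F : set (set (obj L))) :
  F `<=` [set H | hereditary H /\ saturated H] ->
  [set H | hereditary H /\ saturated H] (\bigcap_(H in F) H).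
Proof.
move=> FP; split=> [a Fa H FH|v n sub H FH].
  by apply: (FP _ FH).1; exact: Fa.
by apply: ((FP _ FH).2 v n) => w /sub; apply.
Qed.

Definition hersat_system := ClosureSystem hersat_bigcap.

Definition hersat := closed_set hersat_system.

Lemma order_ideal_bigcap (F : set (set (talented L))) :
  F `<=` [set J | order_ideal J] -> order_ideal (\bigcap_(J in F) J).
Proof.
move=> FP; split=> [J|x y Fx Fy J|n x Fx J|x y xy Fy J] FJ.
- exact: ideal0 (FP _ FJ).
- by apply: (idealD (FP _ FJ)); [exact: Fx|exact: Fy].
- by apply: (ideal_act (FP _ FJ)); exact: Fx.
- by apply: (ideal_le (FP _ FJ) xy); exact: Fy.
Qed.

Definition ideal_system := ClosureSystem order_ideal_bigcap.

Definition ideals := closed_set ideal_system.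

(* The Z^k-order ideal generated by the elements v(0), v in X. *)
Definition ideal_generated (X : set (obj L)) : ideals :=
  hull ideal_system [set gen v 0 | v in X].

End Lattices.

Definition lattice_isomorphism (d1 d2 : Order.disp_t) (L1 : latticeType d1)
    (L2 : latticeType d2) (f : L1 -> L2) : Prop :=
  [/\ bijective f,
      {morph f : x y / Order.meet x y} & {morph f : x y / Order.join x y}].

(* Main.v *)
Require Import Defs.
From mathcomp Require Import all_boot all_order all_algebra boolp classical_sets.
From mathcomp Require Import finmap multiset generic_quotient cardinality.

Set Implicit Arguments.
Unset Strict Implicit.
Unset Printing Implicit Defensive.

Import Order.TTheory GRing.Theory.
Local Open Scope mset_scope.
Local Open Scope quotient_scope.
Local Open Scope classical_set_scope.
Local Open Scope ring_scope.

(** For a hereditary saturated set [H], consider the multisets of symbols all of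
    whose vertices lie in [H].  Replacing [v(n)] by the sum of the
    [s(a)(n + e_i)], [a] in [v Lambda^{e_i}], neither creates nor destroys this
    property: one direction is heredity, the other saturation.  The property is
    therefore invariant under the talented congruence ([supported_congr]) and
    cuts out an order ideal which contains [v(0)] exactly when [v] is in [H];
    since it contains the ideal generated by [H], this gives
    [eta (rho H) = H] ([ideal_generated_vertices]).

    Conversely, for an order ideal [J], a generator [v(n)] lies in [J] iff
    [v(0)] does, because [J] is stable under translation, and a finite sum lies
    in [J] iff all its terms do.  Hence [J] is determined by its vertices
    ([ideal_generated_by_vertices]), and the defining relation says that [v] is
    a vertex of [J] iff the sources of all edges in [v Lambda^{e_i}] are
    ([ideal_vertex_edges]); as [Lambda] has no sources, this relation is
    available for every [v] and every [i].  Induction on the degree extends this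
    from edges to all paths, so that the vertices of [J] form a hereditary
    saturated set.

    Finally, mutually inverse order-preserving maps preserve meets and joins. *)

Lemma mem_fset_set (T : choiceType) (A : set T) (a : T) :
  finite_set A -> a \in fset_set A <-> A a.
Proof. by move=> finA; rewrite in_fset_set //; split=> [/set_mem|/mem_set]. Qed.

(** * Degrees and paths *)

(** Induction on a degree, one standard generator at a time. *)
Lemma degree_ind (k : nat) (P : 'rV[nat]_k -> Prop) :
  P 0 -> (forall i m, P m -> P (delta_mx 0 i + m)) -> forall n, P n.
Proof.
move=> P0 PD n; move sz: (\sum_i n 0%R i)%N => N.
elim: N n sz => [|N IH] n sz.
  suff -> : n = 0 by [].
  apply/rowP => i; rewrite mxE; apply/eqP.
  by move/eqP: sz; rewrite sum_nat_eq0 => /forallP /(_ i).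
have [i ni] : exists i, (0 < n 0%R i)%N.
  apply: contrapT => noi; suff : (\sum_i n 0%R i)%N = 0%N by rewrite sz.
  apply: big1 => i _; apply/eqP; rewrite -leqn0 leqNgt.
  by apply/negP => ni; apply: noi; exists i.
pose m : 'rV[nat]_k := \row_j (n 0%R j - (j == i))%N.
have nE : n = delta_mx 0 i + m.
  apply/rowP => j; rewrite !mxE eqxx /=.
  have [->|_] := eqVneq j i; first by rewrite /= [RHS](subnKC ni).
  by rewrite subn0 add0r.
rewrite nE; apply/PD/IH.
apply: succn_inj; rewrite -sz (bigD1 i) //= [in RHS](bigD1 i) //= mxE eqxx.
rewrite -addSn subn1 prednK //; congr (_ + _)%N.
by apply: eq_bigr => j /negbTE ji; rewrite mxE ji subn0.
Qed.

(** A path of degree 0 is an identity, hence a loop: [r(a) a = a s(a)] are two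
    factorizations of [a] with both factors of degree 0. *)
Lemma src_deg0 (k : nat) (L : kgraph k) (a : mor L) :
  deg a = 0 -> src a = rng a.
Proof.
move=> a0; have a00 : deg a = 0 + 0 by rewrite a0 addr0.
have [p [_ uniq_p]] := @unique_factorization _ L a 0 0 a00.
have p1 : p = (idm (rng a), a).
  by apply: uniq_p; split; rewrite /= ?src_idm ?mcomp_idl ?deg_idm.
have p2 : p = (a, idm (src a)).
  by apply: uniq_p; split; rewrite /= ?rng_idm ?mcomp_idr ?deg_idm.
by move: p2; rewrite p1 => -[<- _]; rewrite src_idm rng_idm.
Qed.

(** Saturation may be checked on edges: if all sources of [v Lambda^{e_i + m}]
    lie in [H], then for each edge [a] in [v Lambda^{e_i}] so do those of
    [s(a) Lambda^m]. *)
Lemma saturated_edges (k : nat) (L : kgraph k) (H : set (obj L)) :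
  (forall v i, (forall a, paths v (delta_mx 0 i) a -> H (src a)) -> H v) ->
  saturated H.
Proof.
move=> satH v n; elim/degree_ind: n v => [|i m IH] v sub.
  by apply: sub; exists (idm v); [split; rewrite ?rng_idm ?deg_idm|rewrite src_idm].
apply: (satH v i) => a [ra da]; apply: IH => _ [b [rb db] <-].
have ab : src a = rng b by rewrite rb.
apply: sub; exists (mcomp a b); last by rewrite src_mcomp.
by split; rewrite ?rng_mcomp ?deg_mcomp ?da ?db.
Qed.

(** Heredity may be checked on edges, since every path factors into edges. *)
Lemma hereditary_edges (k : nat) (L : kgraph k) (H : set (obj L)) :
  (forall v i a, paths v (delta_mx 0 i) a -> H v -> H (src a)) ->
  hereditary H.
Proof.
move=> herH a; move dega: (deg a) => n.
elim/degree_ind: n a dega => [|i m IH] a da; first by rewrite src_deg0.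
have [[b c] [[/= bc aE db dc] _]] := unique_factorization da.
rewrite aE rng_mcomp // src_mcomp // => Hb; apply: IH => //; rewrite -bc.
by apply: herH Hb; split; [|exact: db].
Qed.

(** * The order ideal of a hereditary saturated set *)

(** All vertices occurring in the multiset [x] belong to [H]. *)
Definition supported (k : nat) (L : kgraph k) (H : set (obj L))
  (x : {mset symbol L}) : Prop := forall y, y \in x -> H y.1.

Section Supported.
Variables (k : nat) (L : kgraph k) (H : set (obj L)).

Lemma supportedD (x y : {mset symbol L}) :
  supported H (x `+` y)%mset <-> supported H x /\ supported H y.
Proof.
split=> [xy|[Hx Hy] z]; last by rewrite in_msetD => /orP[/Hx|/Hy].
by split=> z zx; apply: xy; rewrite in_msetD zx ?orbT.
Qed.

Lemma supported1 v n : supported H [mset ((v, n) : symbol L)] <-> H v.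
Proof.
split=> [|Hv y]; last by rewrite in_mset1 => /eqP ->.
by move=> /(_ (v, n)); apply; rewrite in_mset1.
Qed.

Lemma supported_seq (s : seq (symbol L)) :
  supported H (seq_mset s) <-> forall y, y \in s -> H y.1.
Proof.
by split=> Hs y; move: (Hs y); rewrite (perm_mem (perm_eq_seq_mset s)).
Qed.

Lemma supported_shift n (x : {mset symbol L}) :
  supported H x -> supported H (shift n x).
Proof. by move=> Hx; apply/supported_seq => _ /mapP[y yx ->]; exact: (Hx y). Qed.

Hypotheses (hfin : row_finite L) (herH : hereditary H) (satH : saturated H).

Lemma supported_congr (x y : {mset symbol L}) :
  talented_congr x y -> supported H x <-> supported H y.
Proof.
elim=> [v n i _|//|{}x {}y _ [? ?]|{}x {}y z _ [? ?] _ [? ?]|z {}x {}y _ IH].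
- rewrite supported1 supported_seq; split=> [Hv _ /mapP[a aP ->] /=|Hs].
    have [ra _] := (mem_fset_set a (hfin _ _)).1 aP.
    by apply: herH; rewrite ra.
  apply: (satH (n := delta_mx 0 i)) => _ [a aP <-].
  apply: (Hs (src a, n + delta_mx 0 i)); apply/mapP; exists a => //.
  exact/mem_fset_set.
- by split.
- by split=> ?; auto.
- by rewrite !supportedD IH.
Qed.

Lemma supported_pi (x : {mset symbol L}) :
  supported H (repr (\pi_(talented L) x)) <-> supported H x.
Proof. by apply: supported_congr; apply/talentedP; rewrite reprK. Qed.

Lemma supported_repr_add (x y : talented L) :
  supported H (repr (x + y)) <-> supported H (repr x) /\ supported H (repr y).
Proof. by rewrite [x + y]/(talented_add x y) supported_pi supportedD. Qed.

Lemma supported_order_ideal :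
  order_ideal [set x : talented L | supported H (repr x)].
Proof.
split=> /= [|x y Hx Hy|n x Hx|x _ [z ->]].
- by apply/supported_pi => y; rewrite in_mset0.
- exact/supported_repr_add.
- by apply/supported_pi/supported_shift.
- by move=> /supported_repr_add[].
Qed.

(** The ideal generated by [H] acquires no vertex outside [H]: it is contained
    in the order ideal of elements supported in [H]. *)
Lemma ideal_generated_vertices v :
  (ideal_generated H : set (talented L)) (gen v 0) <-> H v.
Proof.
split=> [|Hv]; last by apply: sub_hull; exists v.
move=> /(_ [set x : talented L | supported H (repr x)]) /= Jv.
apply/(@supported1 v 0)/supported_pi/Jv; split; first exact: supported_order_ideal.
by move=> _ [w Hw <-]; apply/supported_pi/supported1.
Qed.

End Supported.

(** * The vertices of an order ideal *)

Lemma talented_sum_gen (k : nat) (L : kgraph k) (x : talented L) :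
  x = \sum_(y <- (repr x : {mset symbol L})) gen y.1 y.2.
Proof. by rewrite -pi_seq_mset seq_mset_id reprK. Qed.

Section Vertices.
Variables (k : nat) (L : kgraph k) (J : set (talented L)).
Hypothesis (idJ : order_ideal J).

Lemma ideal_add (x y : talented L) : J (x + y) <-> J x /\ J y.
Proof.
split=> [Jxy|[]]; last exact: idealD.
by split; apply: (ideal_le idJ) Jxy; [exists y|exists x; rewrite addrC].
Qed.

Lemma ideal_sum (I : eqType) (s : seq I) (F : I -> talented L) :
  J (\sum_(i <- s) F i) <-> forall i, i \in s -> J (F i).
Proof.
elim: s => [|j s IH]; first by rewrite big_nil; split=> // _; exact: ideal0.
rewrite big_cons ideal_add IH; split=> [[Jj Js] i|Js].
  by rewrite inE => /orP[/eqP ->|/Js].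
by split=> [|i si]; apply: Js; rewrite inE ?eqxx ?si ?orbT.
Qed.

Lemma ideal_gen v n : J (gen v n) <-> J (gen v 0).
Proof.
split=> [/(ideal_act idJ (- n))|/(ideal_act idJ n)]; rewrite act_gen.
  by rewrite subrr.
by rewrite add0r.
Qed.

Lemma ideal_vertex_edges v i :
  finite_set (paths v (delta_mx 0 i)) -> paths v (delta_mx 0 i) !=set0 ->
  J (gen v 0) <-> forall a, paths v (delta_mx 0 i) a -> J (gen (src a) 0).
Proof.
move=> fin ne; rewrite (gen_rel 0 ne) ideal_sum.
split=> Ja a.
  by move=> /(mem_fset_set a fin) /Ja /ideal_gen.
by move=> /(mem_fset_set a fin) /Ja Jsa; apply/ideal_gen.
Qed.

End Vertices.

Lemma ideal_generated_by_vertices (k : nat) (L : kgraph k)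
    (J : set (talented L)) : order_ideal J ->
  (ideal_generated [set v | J (gen v 0)] : set (talented L)) = J.
Proof.
move=> idJ; apply/seteqP; split=> x.
  by apply; split=> //= _ [v Jv <-].
rewrite {1}(talented_sum_gen x) => /(ideal_sum idJ) Jx I [/= idI subI].
rewrite (talented_sum_gen x); apply/(ideal_sum idI) => y yx.
by apply/(ideal_gen idI)/subI; exists y.1 => //; apply/(ideal_gen idJ y.1 y.2)/Jx.
Qed.

Lemma ideal_vertices_hersat (k : nat) (L : kgraph k) (J : set (talented L)) :
  row_finite L -> no_sources L -> order_ideal J ->
  hereditary [set v | J (gen v 0)] /\ saturated [set v | J (gen v 0)].
Proof.
move=> hfin hsrc idJ; split.
  apply: hereditary_edges => v i a va /=.
  by move=> /(ideal_vertex_edges idJ (hfin _ _) (hsrc v (delta_mx 0 i))); apply.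
apply: saturated_edges => v i sub /=.
exact/(ideal_vertex_edges idJ (hfin _ _) (hsrc v (delta_mx 0 i))).
Qed.

(** * Order isomorphisms of lattices *)

Lemma homo_cancel_lattice_isomorphism (d1 d2 : Order.disp_t)
    (L1 : latticeType d1) (L2 : latticeType d2) (f : L1 -> L2) (g : L2 -> L1) :
  {homo f : x y / (x <= y)%O} -> {homo g : x y / (x <= y)%O} ->
  cancel f g -> cancel g f -> lattice_isomorphism f.
Proof.
move=> fH gH fK gK; split; first by exists g.
- have gf_le x z : (z <= f x)%O -> (g z <= x)%O by move=> /gH; rewrite fK.
  move=> x y; apply/le_anti/andP; split; first by rewrite lexI !fH ?leIl ?leIr.
  by rewrite -[X in (X <= _)%O]gK fH // lexI !gf_le ?leIl ?leIr.
- have le_gf x z : (f x <= z)%O -> (x <= g z)%O by move=> /gH; rewrite fK.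
  move=> x y; apply/le_anti/andP; split; last by rewrite leUx !fH ?leUl ?leUr.
  by rewrite -[X in (_ <= X)%O]gK fH // leUx !le_gf ?leUl ?leUr.
Qed.

Theorem proposition4p5 (k : nat) (hk : (1 <= k)%N) (L : kgraph k)
  (hfin : row_finite L) (hsrc : no_sources L) :
  exists (rho : hersat L -> ideals L) (eta : ideals L -> hersat L),
    [/\ (forall H : hersat L, rho H = ideal_generated H),
        (forall J : ideals L,
           (eta J : set (obj L)) = [set v | (J : set (talented L)) (gen v 0)]),
        {homo rho : H1 H2 / (H1 <= H2)%O},
        {homo eta : J1 J2 / (J1 <= J2)%O} &
        cancel rho eta /\ cancel eta rho]
    /\ lattice_isomorphism rho.
Proof.
pose rho (H : hersat L) := ideal_generated H.
have etaP (J : ideals L) :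
    `[< closed_in (hersat_system L) [set v | (J : set (talented L)) (gen v 0)] >].
  exact/asboolP/(ideal_vertices_hersat hfin hsrc)/(closed_setP J).
pose eta J : hersat L := ClosedSet (etaP J).
have rho_homo : {homo rho : H1 H2 / (H1 <= H2)%O}.
  move=> H1 H2 /closed_set_leP H12; apply/closed_set_leP/hull_min.
  by move=> _ [v Hv <-]; apply: sub_hull; exists v => //; exact: H12.
have eta_homo : {homo eta : J1 J2 / (J1 <= J2)%O}.
  by move=> J1 J2 /closed_set_leP J12; apply/closed_set_leP => v /= /J12.
have rhoK : cancel rho eta.
  move=> H; apply/val_inj/seteqP.
  have [herH satH] : hereditary H /\ saturated H by exact: (closed_setP H).
  by split=> v /(ideal_generated_vertices hfin herH satH).
have etaK : cancel eta rho.
  by move=> J; apply/val_inj/ideal_generated_by_vertices/(closed_setP J).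
exists rho, eta; split; first by split.
exact: homo_cancel_lattice_isomorphism etaK.
Qed.
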